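(* Let $F$ be a tree with vertex set $\{1,\dots,r\}$. There is a constant $C$ depending only on $F$ such that for every probability space $(\mathcal S,\mu)$ and all $W,W'\in\mathcal W_{\mathrm{sym}}$ we have $t_{\mathrm{isol}}(F,W)\le C$ and $|t_{\mathrm{isol}}(F,W)-t_{\mathrm{isol}}(F,W')|\le C\|W-W'\|_\square$.
   Context: $(\mathcal S,\mu)$ is a probability space; $\mathcal W_{\mathrm{sym}}$ is the set of integrable symmetric measurable $W:\mathcal S^2\to[0,\infty)$. The marginal is $\lambda_W(x)=\int_{\mathcal S}W(x,y)\,d\mu(y)\in[0,\infty]$. For a finite graph $F$ on $\{1,\dots,r\}$, $$t_{\mathrm{isol}}(F,W)=\int_{\mathcal S^r}\prod_{ij\in E(F)}W(x_i,x_j)\prod_{k=1}^re^{-\lambda_W(x_k)}\,d\mu(x_1)\cdots d\mu(x_r).$$ The cut norm is $\|W\|_\square=\sup_{\|f\|_\infty,\|g\|_\infty\le1}\big|\int_{\mathcal S^2}f(x)g(y)W(x,y)\,d\mu(x)d\mu(y)\big|$. *)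

(* Defs.v *)
From HB Require Import structures.
From mathcomp Require Import all_boot all_order all_algebra.
From mathcomp Require Import all_classical all_reals all_analysis.
Set Implicit Arguments. Unset Strict Implicit. Unset Printing Implicit Defensive.
Import Order.TTheory GRing.Theory Num.Theory.
Local Open Scope classical_set_scope.
Local Open Scope ring_scope.

(* ---------- Finite graphs on {0,...,r-1} (vertex k stands for k+1) ---------- *)
Definition simple_graph (r : nat) (e : rel 'I_r) : Prop :=
  (forall i j, e i j = e j i) /\ (forall i, ~~ e i i).

Definition is_tree (r : nat) (e : rel 'I_r) : Prop :=
  simple_graph e /\
  (forall i j : 'I_r, connect e i j) /\
  (forall c : seq 'I_r, (3 <= size c)%N -> ~ ucycle e c).

Section Graphons.
Context {R : realType} {d : measure_display} {T : measurableType d}.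
Variable mu : probability T R.

Definition Wsym (W : T -> T -> R) : Prop :=
  measurable_fun setT (fun z : T * T => W z.1 z.2) /\
  (mu \x mu)%E.-integrable setT (fun z : T * T => (W z.1 z.2)%:E) /\
  (forall x y, W x y = W y x) /\
  (forall x y, 0 <= W x y).

Definition marginal (W : T -> T -> R) (x : T) : \bar R :=
  (\int[mu]_y (W x y)%:E)%E.

Fixpoint iint (n : nat) (g : seq T -> \bar R) : \bar R :=
  match n with
  | 0 => g [::]
  | n'.+1 => (\int[mu]_x iint n' (fun s => g (x :: s)))%E
  end.

Definition t_isol (r : nat) (e : rel 'I_r) (W : T -> T -> R) : \bar R :=
  iint r (fun s =>
    let x := fun i : 'I_r => nth point s i in
    ((\prod_(p : 'I_r * 'I_r | (p.1 < p.2)%N && e p.1 p.2) W (x p.1) (x p.2)) *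
     (\prod_(k : 'I_r) fine (expeR (- marginal W (x k)))))%:E).

Definition cut_norm (U : T -> T -> R) : \bar R :=
  ereal_sup [set v : \bar R | exists (f g : T -> R),
      [/\ measurable_fun setT f, measurable_fun setT g,
           (forall x, `|f x| <= 1), (forall y, `|g y| <= 1) &
           v = `| (\int[mu \x mu]_z (f z.1 * g z.2 * U z.1 z.2)%:E)%E |%E]].
End Graphons.

(* Main.v *)
Require Import Defs.
From HB Require Import structures.
From mathcomp Require Import all_boot all_order all_algebra.
From mathcomp Require Import all_classical all_reals all_analysis.
From mathcomp Require Import measurable_realfun ring lra.
Import Order.TTheory GRing.Theory Num.Theory.
Local Open Scope classical_set_scope.
Local Open Scope ring_scope.

Set Implicit Arguments.
Unset Strict Implicit.
Unset Printing Implicit Defensive.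

(* Let lam be the marginal of W and, for a weight h, let T_W h be the function
   x |-> int W(x, y) h(y) dmu(y). Integrating out a leaf v attached to u removes v
   from the tree and multiplies the weight h_u by T_W h_v; starting from the
   weights exp(-lam), this reduces t_isol to a single integral.

   Two properties survive each step. First, every weight h satisfies
   (1 + lam)^n h <= c_n for all n, because T_W h_v <= c_0 lam. Second, if h and h'
   arise from W and W', then int (1 + min(lam, lam'))^n |h - h'| is at most
   c_n ||W - W'||. For T_W h - T_W' h' this follows by splitting according to which
   of lam(y), lam'(y) is smaller, so that the difference h - h' is integrated
   against the kernel with the smaller marginal, which produces exactly one factor
   min(lam, lam'). The constants c_n depend only on the order of leaf removals. *)

(** * Low-degree vertices in acyclic graphs *)

Section Acyclic.
Variables (V : finType) (e : rel V).
Hypothesis e_sym : forall i j, e i j = e j i.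
Hypothesis e_irr : forall i, ~~ e i i.
Hypothesis acyclic : forall c : seq V, (3 <= size c)%N -> ~ ucycle e c.

(* If every vertex of A had two neighbours in A, any simple path in A could be
   prolonged, since returning to the path would close a cycle. *)
Lemma acyclic_low_degree (A : {set V}) :
  A != finset.set0 ->
  exists2 v, v \in A &
    forall w w', w \in A -> w' \in A -> e v w -> e v w' -> w = w'.
Proof.
move=> A0; apply: contrapT => noleaf.
have two v : v \in A -> exists w w',
    [/\ w \in A, w' \in A, e v w, e v w' & w != w'].
  move=> vA; apply: contrapT => N; apply: noleaf; exists v => // w w' wA w'A vw vw'.
  by apply/eqP/negPn/negP => ww'; apply: N; exists w, w'.
have ext n : exists x p, [/\ size p = n, path e x p, uniq (x :: p)
    & all [in A] (x :: p)].
  elim: n => [|n [x [p [sp xp up Ap]]]].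
    by case/set0Pn: A0 => x xA; exists x, [::]; rewrite /= xA.
  have xA : x \in A by case/andP: Ap.
  have [w [w' [wA w'A xw xw' ww']]] := two x xA.
  (* Of two distinct neighbours, at least one differs from the successor of [x] on the path ([x]
     itself when [p] is empty). If this [z] lies further along the path, the cycle it closes has
     length at least 3. *)
  have [z [zA xz zh]] : exists z, [/\ z \in A, e x z & z != head x p].
    have [wE|wN] := eqVneq w (head x p).
      by exists w'; split => //; rewrite -wE eq_sym.
    by exists w.
  have [zp|zp] := boolP (z \in x :: p); last first.
    exists z, (x :: p); split => //=; first by rewrite sp.
    - by rewrite e_sym xz.
    - by rewrite zp.
    - by rewrite zA.
  exfalso; move: zp; rewrite inE; case: eqP => [zx _|_ /= zp].
    by move: (e_irr x); rewrite -{2}zx xz.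
  move: xp up zh {sp Ap}; case/splitPr: zp => p1 p2.
  rewrite -cat_rcons cat_path => /andP[xp1 _] up zh.
  apply: (acyclic (c := x :: rcons p1 z)).
    case: p1 zh {xp1 up} => [|a p1] /=; first by rewrite eqxx.
    by rewrite size_rcons.
  rewrite /ucycle /cycle rcons_path xp1 last_rcons e_sym xz /=.
  by move: up; rewrite -cat_cons cat_uniq => /andP[].
(* A simple path with [#|V| + 1] vertices cannot exist. *)
have [x [p [sp _ up _]]] := ext #|V|.
by have := max_card (mem (x :: p)); move/card_uniqP: up => ->; rewrite /= sp ltnn.
Qed.
End Acyclic.

(** * Tonelli's theorem for iterated integrals over sequences *)

Section IteratedIntegral.
Context {R : realType} {d : measure_display} {T : measurableType d}.
Variable mu : probability T R.
Local Open Scope ereal_scope.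

Lemma eq_iint n (g g' : seq T -> \bar R) :
  (forall s, size s = n -> g s = g' s) -> iint mu n g = iint mu n g'.
Proof.
elim: n g g' => [|n IH] g g' gg' /=; first exact: gg'.
by apply: eq_integral => x _; apply: IH => s sn; apply: gg'; rewrite /= sn.
Qed.

Lemma iint1 n : iint mu n (cst 1) = 1.
Proof.
elim: n => //= n IH; under eq_integral do rewrite IH.
by rewrite (integral_cst mu measurableT 1) [X in _ * X]probability_setT mule1.
Qed.

Lemma iint_ge0 n (g : seq T -> \bar R) :
  (forall s, 0 <= g s) -> 0 <= iint mu n g.
Proof.
elim: n g => [|n IH] g g0 /=; first exact: g0.
by apply: integral_ge0 => x _; apply: IH.
Qed.

(* Joint measurability on P x T^n, tested against all measurable maps
   Q -> P x T^n; this avoids putting a sigma-algebra on sequences. *)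
Definition jmeas (d' : measure_display) (P : measurableType d') (n : nat)
    (G : P -> seq T -> \bar R) : Prop :=
  forall (dq : measure_display) (Q : measurableType dq) (p : Q -> P)
         (s : Q -> seq T),
    measurable_fun setT p -> (forall q, size (s q) = n) ->
    (forall i, measurable_fun setT (fun q => nth point (s q) i)) ->
    measurable_fun setT (fun q => G (p q) (s q)).

(** Moves the head of the sequence into the parameter space; the inductions on [n] below pass
    through one integration in this way. *)
Lemma jmeas_cons (d' : measure_display) (P : measurableType d') (n : nat)
    (G : P -> seq T -> \bar R) :
  @jmeas _ P n.+1 G ->
  @jmeas _ (P * T)%type n (fun z s => G z.1 (z.2 :: s)).
Proof.
move=> mG dq Q p s mp ss ms; apply: (mG _ _ (fst \o p) (fun q => (p q).2 :: s q)).
- exact: measurableT_comp.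
- by move=> q /=; rewrite ss.
- case=> [|i] //=; exact: (measurableT_comp measurable_snd mp).
Qed.

Lemma jmeas_comp (d' d2 : measure_display) (P : measurableType d')
    (P' : measurableType d2) (n : nat) (f : P' -> P) (G : P -> seq T -> \bar R) :
  measurable_fun setT f -> @jmeas _ P n G -> @jmeas _ P' n (fun z s => G (f z) s).
Proof.
move=> mf mG dq Q p s mp ss ms; apply: (mG _ _ (f \o p) s) => //.
exact: measurableT_comp.
Qed.

Lemma measurable_iint (d' : measure_display) (P : measurableType d') (n : nat)
    (G : P -> seq T -> \bar R) :
  @jmeas _ P n G -> (forall p s, 0 <= G p s) ->
  measurable_fun setT (fun p => iint mu n (G p)).
Proof.
elim: n d' P G => [|n IH] d' P G mG G0 /=.
  apply: (mG _ _ id (cst [::])) => // i.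
  by under eq_fun do rewrite nth_nil; exact: measurable_cst.
apply: (measurable_fun_fubini_tonelli_F
  (fun z : P * T => iint mu n (fun s => G z.1 (z.2 :: s)))).
  by apply: (IH _ _ (fun z s => G z.1 (z.2 :: s))) => //; exact: jmeas_cons.
by move=> z; apply: iint_ge0.
Qed.

(** The outer variable is moved inwards past one integration at a time, each exchange being Tonelli
    on a product of two copies of the space. *)
Lemma integral_iint n (G : T -> seq T -> \bar R) :
  @jmeas _ T n G -> (forall p s, 0 <= G p s) ->
  \int[mu]_y iint mu n (G y) = iint mu n (fun s => \int[mu]_y G y s).
Proof.
elim: n G => [//|n IH] G mG G0 /=.
rewrite (fubini_tonelli (fun z : T * T => iint mu n (fun s => G z.1 (z.2 :: s)))) /=.
- apply: eq_integral => x _; apply: IH => //.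
  apply: (jmeas_comp (f := fun y => (y, x)) _ (jmeas_cons mG)).
  exact: measurable_pair2.
- apply: (measurable_iint (G := fun z s => G z.1 (z.2 :: s))) => //.
  exact: jmeas_cons.
- by move=> z; apply: iint_ge0.
Qed.

Lemma jmeas_unit_cons n (g : seq T -> \bar R) :
  @jmeas _ unit n.+1 (fun=> g) -> @jmeas _ T n (fun x s => g (x :: s)).
Proof.
move=> mg; apply: (jmeas_comp (f := fun y => (tt, y)) _ (jmeas_cons mg)).
exact: measurable_pair1.
Qed.

(* Tonelli moves the variable v innermost; the outer variable v is then idle,
   and integrating it contributes a factor 1. *)
Lemma iint_innermost n (v : nat) (g : seq T -> \bar R) :
  (v < n)%N -> @jmeas _ unit n (fun=> g) -> (forall s, 0 <= g s) ->
  iint mu n g = iint mu n (fun s => \int[mu]_y g (set_nth point s v y)).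
Proof.
elim: n v g => [//|n IH] [|v] g vn mg g0 /=.
  rewrite (integral_cst mu measurableT (iint mu n _)).
  rewrite [X in _ * X]probability_setT mule1.
  by apply: integral_iint => //; exact: jmeas_unit_cons.
apply: eq_integral => x _; apply: (IH v (fun s => g (x :: s))) => //.
by apply: (jmeas_comp (f := fun=> x) _ (jmeas_unit_cons mg)).
Qed.

Lemma iintZ n (k : R) (g : seq T -> \bar R) :
  (0 <= k)%R -> @jmeas _ unit n (fun=> g) -> (forall s, 0 <= g s) ->
  iint mu n (fun s => k%:E * g s) = k%:E * iint mu n g.
Proof.
move=> k0; elim: n g => [//|n IH] g mg g0 /=.
have mg' := jmeas_unit_cons mg.
under eq_integral => x _.
  rewrite (IH (fun s => g (x :: s))) //; last first.
    by apply: (jmeas_comp (f := fun=> x) _ mg').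
  over.
rewrite ge0_integralZl //; first exact: measurable_iint.
by move=> x _; exact: iint_ge0.
Qed.

End IteratedIntegral.

(** * The integral operator of a single kernel *)

Section KernelOperator.
Context {R : realType} {d : measure_display} {T : measurableType d}.
Variable mu : probability T R.

(** The operator T_W. For a bounded weight the integral can be infinite only where the marginal is;
    the value 0 given by [fine] there is harmless, since it is later multiplied by a weight that
    vanishes at such points. *)
Definition kernel_op (W : T -> T -> R) (h : T -> R) (x : T) : R :=
  fine (\int[mu]_y (W x y * h y)%:E)%E.

Section OneKernel.
Variable W : T -> T -> R.
Hypothesis WW : Wsym mu W.

Let mW : measurable_fun setT (fun z : T * T => W z.1 z.2).
Proof. by case: WW. Qed.

Let W0 x y : 0 <= W x y.
Proof. by case: WW => _ [_ [_]]; apply. Qed.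

Lemma Wsym_measurable_section x : measurable_fun setT (W x).
Proof. exact: (measurableT_comp mW (measurable_pair1 x)). Qed.

Lemma measurable_marginal : measurable_fun setT (marginal mu W).
Proof.
apply: (measurable_fun_fubini_tonelli_F (fun z : T * T => (W z.1 z.2)%:E)).
  exact/measurable_EFinP.
by move=> z; rewrite lee_fin.
Qed.

Lemma marginal_ge0 x : (0 <= marginal mu W x)%E.
Proof. by apply: integral_ge0 => y _; rewrite lee_fin. Qed.

Lemma marginal_fineK x :
  (marginal mu W x < +oo)%E -> ((fine (marginal mu W x))%:E = marginal mu W x)%E.
Proof. by move=> h; rewrite fineK// ge0_fin_numE// marginal_ge0. Qed.

Lemma fine_marginal_ge0 x : 0 <= fine (marginal mu W x).
Proof. by rewrite fine_ge0// marginal_ge0. Qed.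

Variable h : T -> R.
Hypothesis mh : measurable_fun setT h.
Hypothesis h0 : forall y, 0 <= h y.

Lemma measurable_kernelM :
  measurable_fun setT (fun z : T * T => W z.1 z.2 * h z.2).
Proof. by apply: measurable_funM => //; exact: measurableT_comp. Qed.

Lemma measurable_kernelM_section x : measurable_fun setT (fun y => W x y * h y).
Proof. by apply: measurable_funM => //; exact: Wsym_measurable_section. Qed.

Lemma measurable_kernel_op : measurable_fun setT (kernel_op W h).
Proof.
apply: (measurableT_comp (fine_measurable measurableT)).
apply: (measurable_fun_fubini_tonelli_F
  (fun z : T * T => (W z.1 z.2 * h z.2)%:E)).
  apply/measurable_EFinP; exact: measurable_kernelM.
by move=> z; rewrite lee_fin mulr_ge0.
Qed.

Lemma kernel_op_ge0 x : 0 <= kernel_op W h x.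
Proof.
by rewrite fine_ge0//; apply: integral_ge0 => y _; rewrite lee_fin mulr_ge0.
Qed.

Variable c : R.
Hypothesis hc : forall y, h y <= c.

Let c0 : 0 <= c.
Proof. exact: le_trans (h0 point) (hc point). Qed.

Lemma kernel_integral_le x :
  (\int[mu]_y (W x y * h y)%:E <= c%:E * marginal mu W x)%E.
Proof.
have mWx := Wsym_measurable_section x.
rewrite /marginal -ge0_integralZl_EFin//; last 2 first.
- by move=> y _; rewrite lee_fin.
- exact/measurable_EFinP.
apply: ge0_le_integral => //.
- by move=> y _; rewrite lee_fin mulr_ge0.
- apply/measurable_EFinP; exact: measurable_kernelM_section.
- by apply/measurable_EFinP; apply: measurable_funM.
- by move=> y _; rewrite -EFinM lee_fin mulrC ler_wpM2r.
Qed.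

Lemma kernel_op_fineK x : (marginal mu W x < +oo)%E ->
  ((kernel_op W h x)%:E = \int[mu]_y (W x y * h y)%:E)%E.
Proof.
move=> fx; rewrite fineK// ge0_fin_numE; last first.
  by apply: integral_ge0 => y _; rewrite lee_fin mulr_ge0.
apply: le_lt_trans (kernel_integral_le x) _.
by rewrite -(marginal_fineK fx) -EFinM ltry.
Qed.

Lemma kernel_op_le x : (marginal mu W x < +oo)%E ->
  kernel_op W h x <= c * fine (marginal mu W x).
Proof.
move=> fx; rewrite -lee_fin (kernel_op_fineK fx) EFinM (marginal_fineK fx).
exact: kernel_integral_le.
Qed.

Lemma integrable_kernelM :
  (mu \x mu)%E.-integrable setT (fun z : T * T => (W z.1 z.2 * h z.2)%:E).
Proof.
have iW : (mu \x mu)%E.-integrable setT (fun z : T * T => (W z.1 z.2)%:E).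
  by case: WW => _ [].
apply: (le_integrable measurableT _ _ (integrableZl measurableT c iW)).
  apply/measurable_EFinP; exact: measurable_kernelM.
move=> z _; rewrite -EFinM /= lee_fin !ger0_norm ?mulr_ge0//.
by rewrite mulrC ler_wpM2r.
Qed.

End OneKernel.

(** By Fubini, the inner integrals of an integrable kernel form an integrable function, which is
    finite almost everywhere. *)
Lemma ae_marginal_lty W : Wsym mu W ->
  {ae mu, forall x, (marginal mu W x < +oo)%E}.
Proof.
move=> [_ [iW [_ W0]]].
have := integrable_ae measurableT (integrable_fubini_F iW).
apply: filterS => x /(_ I); rewrite ge0_fin_numE//.
by apply: integral_ge0 => y _; rewrite lee_fin.
Qed.

End KernelOperator.

(** * Comparison of two kernels through the cut norm *)

Section TwoKernels.
Context {R : realType} {d : measure_display} {T : measurableType d}.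
Variables (mu : probability T R) (W W' : T -> T -> R) (D : R).
Hypotheses (WW : Wsym mu W) (WW' : Wsym mu W').

(** The cut norm of W - W' is at most [D], spelled out on test functions. With a real [D] all later
    estimates stay finite; an infinite cut norm is treated separately at the end. *)
Definition cut_bounded : Prop := forall f g : T -> R,
  measurable_fun setT f -> measurable_fun setT g ->
  (forall x, `|f x| <= 1) -> (forall x, `|g x| <= 1) ->
  (`| \int[mu \x mu]_z (f z.1 * g z.2 * (W z.1 z.2 - W' z.1 z.2))%:E |
     <= D%:E)%E.

(** Since [fine] is applied after the minimum, the value is the true minimum as soon as one marginal
    is finite; it is 0 where both are infinite. *)
Definition min_marginal (x : T) : R :=
  fine (mine (marginal mu W x) (marginal mu W' x)).

Lemma measurable_min_marginal : measurable_fun setT min_marginal.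
Proof.
apply: (measurableT_comp (fine_measurable measurableT)).
by apply: measurable_mine; exact: measurable_marginal.
Qed.

Lemma min_marginal_ge0 x : 0 <= min_marginal x.
Proof.
by rewrite fine_ge0// le_min (marginal_ge0 WW) (marginal_ge0 WW').
Qed.

Hypothesis cutD : cut_bounded.

Lemma cut_bounded_ge0 : 0 <= D.
Proof.
have := cutD (f := cst 0) (g := cst 0); rewrite -lee_fin.
by move=> H; apply: le_trans (abse_ge0 _) (H _ _ _ _) => // x; rewrite normr0.
Qed.

(* The integrand W h - W' h' is split as q (W - W') + K (h - h'), where at each
   y the kernel K is the one of W, W' with the smaller marginal at y and q is
   the weight, h' or h, of the other kernel. *)
Lemma kernel_op_L1_dist (h h' : T -> R) (c : R) :
  measurable_fun setT h -> measurable_fun setT h' ->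
  (forall y, 0 <= h y) -> (forall y, 0 <= h' y) ->
  0 < c -> (forall y, h y <= c) -> (forall y, h' y <= c) ->
  (forall y, marginal mu W y = +oo%E -> marginal mu W' y = +oo%E -> h y = h' y) ->
  (\int[mu]_x `|kernel_op mu W h x - kernel_op mu W' h' x|%:E <=
   (c * D)%:E + \int[mu]_y (min_marginal y * `|h y - h' y|)%:E)%E.
Proof.
move=> mh mh' h0 h'0 c0 hc h'c hoo.
have [mW [iW [symW W0]]] := WW; have [mW' [iW' [symW' W'0]]] := WW'.
pose g := kernel_op mu W h; pose g' := kernel_op mu W' h'.
have mg : measurable_fun setT g by exact: measurable_kernel_op.
have mg' : measurable_fun setT g' by exact: measurable_kernel_op.
(* The sign of [g - g'] turns the absolute value into a linear expression and serves as the first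
   test function for the cut norm. *)
pose sg x : R := if g' x <= g x then 1 else -1.
have msg : measurable_fun setT sg.
  by apply: measurable_fun_ifT => //; exact: measurable_fun_ler.
have sg1 x : `|sg x| = 1 by rewrite /sg; case: ifP; rewrite ?normrN normr1.
have sgE x : `|g x - g' x| = sg x * (g x - g' x).
  rewrite /sg; case: leP => gg; first by rewrite mul1r ger0_norm ?subr_ge0.
  by rewrite mulN1r ltr0_norm// subr_lt0.
pose B y := (marginal mu W y <= marginal mu W' y)%E.
have mB : measurable_fun setT B.
  by apply: measurable_fun_lee; exact: measurable_marginal.
pose q y := if B y then h' y else h y.
have mq : measurable_fun setT q by apply: measurable_fun_ifT.
have q0 y : 0 <= q y by rewrite /q; case: ifP.
have qc y : q y <= c by rewrite /q; case: ifP.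
pose K (z : T * T) := if B z.2 then W z.1 z.2 else W' z.1 z.2.
have mK : measurable_fun setT K.
  by apply: measurable_fun_ifT => //; exact: measurableT_comp.
have K0 z : 0 <= K z by rewrite /K; case: ifP.
(* Division by [c] makes [q] an admissible second test function; the factor [c] reappears in
   [fE]. *)
have qc1 y : `|q y / c| <= 1.
  rewrite ger0_norm; last by rewrite divr_ge0// ltW.
  by rewrite ler_pdivrMr// mul1r.
have ip := integrable_kernelM WW mh h0 hc.
have ip' := integrable_kernelM WW' mh' h'0 h'c.
set p := (fun z : T * T => (W z.1 z.2 * h z.2)%:E) in ip.
set p' := (fun z : T * T => (W' z.1 z.2 * h' z.2)%:E) in ip'.
have msg1 : measurable_fun setT (fun z : T * T => sg z.1) by exact: measurableT_comp.
have mq2 : measurable_fun setT (fun z : T * T => q z.2) by exact: measurableT_comp.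
have mh2 : measurable_fun setT (fun z : T * T => h z.2) by exact: measurableT_comp.
have mh'2 : measurable_fun setT (fun z : T * T => h' z.2) by exact: measurableT_comp.
pose f (z : T * T) := (sg z.1 * (W z.1 z.2 * h z.2 - W' z.1 z.2 * h' z.2))%:E.
pose u (z : T * T) := sg z.1 * (q z.2 / c) * (W z.1 z.2 - W' z.1 z.2).
pose f2 (z : T * T) := (sg z.1 * K z * (h z.2 - h' z.2))%:E.
have mf : measurable_fun setT f.
  apply/measurable_EFinP/measurable_funM => //.
  by apply: measurable_funB; apply: measurable_funM.
have intf : (mu \x mu)%E.-integrable setT f.
  apply: (le_integrable measurableT mf _ (integrableD measurableT ip ip')).
  move=> z _; rewrite /f /p /p' /= lee_fin normrM sg1 mul1r.
  rewrite [leRHS]ger0_norm ?addr_ge0 ?mulr_ge0//.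
  by rewrite (le_trans (ler_normB _ _))// !ger0_norm ?mulr_ge0.
have mu_ : measurable_fun setT u.
  apply: measurable_funM; last exact: measurable_funB.
  apply: measurable_funM => //; exact: measurable_funM.
have intu : (mu \x mu)%E.-integrable setT (EFin \o u).
  have := integrableD measurableT iW iW'.
  apply: le_integrable => //; first exact/measurable_EFinP.
  move=> z _; rewrite /u /= lee_fin normrM [leRHS]ger0_norm ?addr_ge0//.
  rewrite normrM sg1 mul1r (le_trans (ler_wpM2r _ (qc1 _)))// mul1r.
  by rewrite (le_trans (ler_normB _ _))// !ger0_norm.
have fE z : (f z = c%:E * (u z)%:E + f2 z)%E.
  rewrite /f /u /f2 /q /K -EFinM -EFinD; congr EFin.
  have cn : c != 0 by rewrite gt_eqF.
  by case: ifP => _; field.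
have mf2 : measurable_fun setT f2.
  apply/measurable_EFinP; apply: measurable_funM; first exact: measurable_funM.
  exact: measurable_funB.
have f2E z : (f2 z = f z - c%:E * (u z)%:E)%E.
  by rewrite fE -EFinM /f2 -!EFinD addrAC subrr add0r.
have intcu := integrableZl measurableT c intu.
have intf2 : (mu \x mu)%E.-integrable setT f2.
  rewrite (_ : f2 = f \- (fun z => c%:E * (u z)%:E))%E; last exact/funext.
  exact: integrableB.
(* Fubini. The integrands agree only almost everywhere, because linearity of the inner integral
   needs both sections at [x] to be integrable. *)
have -> : (\int[mu]_x `|g x - g' x|%:E = \int[mu \x mu]_z f z)%E.
  rewrite -(integral12_prod_meas1 intf); apply: ae_eq_integral => //.
  - apply/measurable_EFinP/measurableT_comp => //; exact: measurable_funB.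
  - exact: (measurable_fubini_F intf).
  - have := ae_integrable1 ip; have := ae_integrable1 ip'.
    apply: filterS2 => x ipx' ipx _.
    rewrite /fubini_F /f /=.
    under eq_integral do rewrite EFinM EFinB.
    rewrite integralZl//; last exact: integrableB.
    rewrite integralB// -(fineK (integrable_fin_num measurableT ipx)).
    rewrite -(fineK (integrable_fin_num measurableT ipx')).
    by rewrite sgE.
under eq_integral do rewrite fE.
rewrite integralD// integralZl//.
apply: le_trans (lee_abs _) _; apply: le_trans (lee_abs_add _ _) _.
apply: leeD.
  rewrite abseM EFinM abse_EFin (ger0_norm (ltW c0)).
  apply: lee_wpmul2l; first by rewrite lee_fin ltW.
  apply: (cutD (f := sg) (g := fun y => q y / c)) => //.
  - exact: measurable_funM.
  - by move=> x; rewrite sg1.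
apply: le_trans (le_abse_integral _ measurableT mf2) _.
pose k (z : T * T) := (K z * `|h z.2 - h' z.2|)%:E.
have mk : measurable_fun setT k.
  apply/measurable_EFinP/measurable_funM => //; apply: measurableT_comp => //.
  exact: measurable_funB.
have k0 z : (0 <= k z)%E by rewrite lee_fin mulr_ge0.
rewrite (eq_integral k); last first.
  by move=> z _; rewrite /f2 /k abse_EFin !normrM sg1 mul1r ger0_norm.
(* With [y] fixed, the choice between the two kernels in [K] is fixed as well, so the integral over
   [x] is, by symmetry of the kernels, the smaller marginal at [y]. *)
rewrite (fubini_tonelli2 k mk k0) le_eqVlt; apply/orP; left; apply/eqP.
apply: eq_integral => y _; rewrite /fubini_G /k /K /=.
have mWy : measurable_fun setT (W ^~ y)
  by apply: (measurableT_comp mW (measurable_pair2 y)).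
have mWy' : measurable_fun setT (W' ^~ y)
  by apply: (measurableT_comp mW' (measurable_pair2 y)).
have lamE : (\int[mu]_x (W x y)%:E = marginal mu W y)%E.
  by apply: eq_integral => x _; rewrite symW.
have lamE' : (\int[mu]_x (W' x y)%:E = marginal mu W' y)%E.
  by apply: eq_integral => x _; rewrite symW'.
(* Where both marginals are infinite, [hoo] gives [h y = h' y] and both sides are 0. *)
have minE : (mine (marginal mu W y) (marginal mu W' y) * `|h y - h' y|%:E =
    (min_marginal y * `|h y - h' y|)%:E)%E.
  rewrite /min_marginal EFinM.
  have [|fin] := ltP (mine (marginal mu W y) (marginal mu W' y)) +oo%E.
    move=> fin; rewrite fineK// ge0_fin_numE//.
    by rewrite le_min (marginal_ge0 WW) (marginal_ge0 WW').
  move: fin; rewrite le_min !leye_eq => /andP[/eqP l /eqP l'].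
  by rewrite (hoo y l l') subrr normr0 !mule0.
rewrite -minE minElt.
under eq_integral do rewrite EFinM.
rewrite ge0_integralZr//; last 2 first.
- by apply/measurable_EFinP; apply: measurable_fun_ifT.
- by move=> x _; rewrite lee_fin; case: ifP.
congr (_ * _)%E; rewrite /B; case: ltgtP => [l|l|l].
- by rewrite lamE.
- by rewrite lamE'.
- by rewrite lamE l.
Qed.

End TwoKernels.

(** * Weights decaying in the marginal, and their stability under attaching a leaf *)

Section WeightedPairs.
Context {R : realType} {d : measure_display} {T : measurableType d}.
Variable mu : probability T R.

(* Where the marginal is infinite, fine returns 0, so the bound alone would not
   force h to vanish there. *)
Record admissible (W : T -> T -> R) (c : nat -> R) (h : T -> R) : Prop := {
  adm_meas : measurable_fun setT h;
  adm_ge0 : forall x, 0 <= h x;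
  adm_infty : forall x, marginal mu W x = +oo%E -> h x = 0;
  adm_bound : forall n x, (1 + fine (marginal mu W x)) ^+ n * h x <= c n }.

(** All exponents are controlled at once because each attachment consumes one power of the marginal.
    The sequence [c] is shared by both weights and by their distance, and does not involve the
    kernels. *)
Record close_pair (W W' : T -> T -> R) (D : R) (c : nat -> R) (h h' : T -> R) :
    Prop := {
  close_adm : admissible W c h;
  close_adm' : admissible W' c h';
  close_dist : forall n,
    (\int[mu]_x ((1 + min_marginal mu W W' x) ^+ n * `|h x - h' x|)%:E
       <= (c n * D)%:E)%E }.

Lemma admissible_le W c h x : admissible W c h -> h x <= c 0%N.
Proof. by move=> /adm_bound /(_ 0%N x); rewrite expr0 mul1r. Qed.

Lemma admissible_const_ge0 W c h n : Wsym mu W -> admissible W c h -> 0 <= c n.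
Proof.
move=> WW ah; apply: le_trans (adm_bound ah n point).
by rewrite mulr_ge0 ?(adm_ge0 ah)// exprn_ge0// addr_ge0// (fine_marginal_ge0 WW).
Qed.

Lemma admissible_integral W c h : admissible W c h ->
  (0 <= \int[mu]_x (h x)%:E <= (c 0%N)%:E)%E.
Proof.
move=> ah; have h0 := adm_ge0 ah; apply/andP; split.
  by apply: integral_ge0 => y _; rewrite lee_fin.
rewrite [leRHS](_ : _ = \int[mu]_y cst (c 0%N)%:E y)%E; last first.
  by rewrite (integral_cst mu measurableT) [X in (_ * X)%E]probability_setT mule1.
apply: ge0_le_integral => //.
- by move=> y _; rewrite lee_fin.
- exact/measurable_EFinP/(adm_meas ah).
- by move=> y _; rewrite lee_fin; exact: (admissible_le y ah).
Qed.

Lemma admissible_integrable W c h : admissible W c h ->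
  mu.-integrable setT (EFin \o h).
Proof.
move=> ah; apply/integrableP; split; first exact/measurable_EFinP/(adm_meas ah).
under eq_integral => x _ do rewrite /= ger0_norm ?(adm_ge0 ah)//.
by case/andP: (admissible_integral ah) => _ /le_lt_trans; apply; rewrite ltry.
Qed.

Lemma lty_or_infty (x : \bar R) : (x < +oo)%E \/ x = +oo%E.
Proof. by case: (ltP x +oo%E) => [|]; [left|rewrite leye_eq => /eqP; right]. Qed.

(** The first term comes from the bound (cv 0 + 1)(1 + lam) on T_W hv, which uses the estimate for
    [hu] at exponent n + 1. The second is [cu n] times the L1 bound on the difference of the two
    operators. Adding 1 to [cv 0] gives the strictly positive bound on the weights that
    [kernel_op_L1_dist] divides by. *)
Definition attach_const (cu cv : nat -> R) (n : nat) : R :=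
  cu n.+1 * (cv 0%N + 1) + cu n * (cv 0%N + 1 + cv 1%N).

(** The operator contributes at most a constant times 1 + lam, and the bound on [hu] at exponent n +
    1 absorbs this factor. *)
Lemma admissible_attach W cu cv hu hv : Wsym mu W ->
  admissible W cu hu -> admissible W cv hv ->
  admissible W (attach_const cu cv) (fun x => hu x * kernel_op mu W hv x).
Proof.
move=> WW au av.
have cu0 n := admissible_const_ge0 n WW au.
have cv0 n := admissible_const_ge0 n WW av.
have mv := adm_meas av; have v0 := adm_ge0 av.
split.
- by apply: measurable_funM; [exact: adm_meas au|exact: measurable_kernel_op].
- by move=> x; rewrite mulr_ge0 ?(adm_ge0 au)// kernel_op_ge0.
- by move=> x l; rewrite (adm_infty au l) mul0r.
move=> n x; have [l|l] := lty_or_infty (marginal mu W x); last first.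
  by rewrite (adm_infty au l) mul0r mulr0 addr_ge0 ?mulr_ge0 ?addr_ge0.
have l0 := fine_marginal_ge0 WW x.
have := kernel_op_le WW mv v0 (fun y => admissible_le y av) l.
have := adm_bound au n.+1 x; rewrite exprS.
move: (fine _) l0 (adm_bound au n x) => L L0 Bn Bn1 kle.
have k0 := kernel_op_ge0 WW v0 x.
apply: (le_trans (y := cu n.+1 * (cv 0%N + 1))); last first.
  by rewrite lerDl mulr_ge0// !addr_ge0.
have P0 : 0 <= (1 + L) ^+ n * hu x by rewrite mulr_ge0 ?exprn_ge0 ?addr_ge0 ?(adm_ge0 au).
rewrite mulrA; apply: (le_trans (y := ((1 + L) ^+ n * hu x) * ((cv 0%N + 1) * (1 + L)))).
  apply: ler_wpM2l => //; apply: le_trans kle _.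
  by have := cv0 0%N; nra.
rewrite [leLHS](_ : _ = ((1 + L) * (1 + L) ^+ n * hu x) * (cv 0%N + 1)); last by ring.
by apply: ler_wpM2r => //; rewrite addr_ge0.
Qed.

(** Telescoping: the difference of products is (hu - hu')g + hu'(g - g'). The growth of [g], at most
    linear in [M], costs one further power of 1 + M; the decay of [hu'] absorbs the weight in the
    second term. *)
Lemma product_dist_le (M a k : R) (n : nat) (hu hu' g g' : R) :
  0 <= M -> 0 <= g -> 0 <= hu' -> 0 <= a -> g <= a * M ->
  (1 + M) ^+ n * hu' <= k ->
  (1 + M) ^+ n * `|hu * g - hu' * g'| <=
    a * ((1 + M) ^+ n.+1 * `|hu - hu'|) + k * `|g - g'|.
Proof.
move=> M0 g0 hu'0 a0 gM hk.
have P0 : 0 <= (1 + M) ^+ n by rewrite exprn_ge0// addr_ge0.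
have -> : hu * g - hu' * g' = (hu - hu') * g + hu' * (g - g') by ring.
apply: (le_trans (ler_wpM2l P0 (ler_normD _ _))).
rewrite mulrDr !normrM (ger0_norm g0) (ger0_norm hu'0); apply: lerD.
  rewrite exprS [leRHS](_ : _ = (1 + M) ^+ n * (`|hu - hu'| * (a * (1 + M)))); last by ring.
  apply: ler_wpM2l => //; apply: ler_wpM2l => //.
  by apply: le_trans gM _; rewrite ler_wpM2l// lerDr.
by rewrite mulrA; apply: ler_wpM2r.
Qed.

Section Pairs.
Variables (W W' : T -> T -> R) (D : R).
Hypotheses (WW : Wsym mu W) (WW' : Wsym mu W').
Hypothesis cutD : cut_bounded mu W W' D.
Local Notation m := (min_marginal mu W W').

Lemma measurable_weight n : measurable_fun setT (fun x => (1 + m x) ^+ n).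
Proof.
by apply: measurable_funX; apply: measurable_funD => //; exact: measurable_min_marginal.
Qed.

Lemma weight_ge0 n x : 0 <= (1 + m x) ^+ n.
Proof. by rewrite exprn_ge0// addr_ge0// min_marginal_ge0. Qed.

(* At each point the telescoping of the product is arranged so that the factor
   kept from the pair (hu, hu') belongs to the kernel with the larger marginal. *)
Lemma attach_dist_pointwise cu cv hu hu' hv hv' n x :
  admissible W cu hu -> admissible W' cu hu' ->
  admissible W cv hv -> admissible W' cv hv' ->
  (1 + m x) ^+ n *
    `|hu x * kernel_op mu W hv x - hu' x * kernel_op mu W' hv' x| <=
  (cv 0%N + 1) * ((1 + m x) ^+ n.+1 * `|hu x - hu' x|) +
  cu n * `|kernel_op mu W hv x - kernel_op mu W' hv' x|.
Proof.
move=> au au' av av'.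
have cu0 := admissible_const_ge0 n WW au.
have cv0 := admissible_const_ge0 0 WW av.
have k0 := kernel_op_ge0 WW (adm_ge0 av) x.
have k0' := kernel_op_ge0 WW' (adm_ge0 av') x.
have m0 := min_marginal_ge0 WW WW' x.
(* Here [U] is whichever kernel has the smaller marginal at [x]. Both orders of the marginals are
   instances, the second after reversing the differences inside the absolute values. *)
have key U U' ku ku' h1 h1' (h2 : T -> R) :
    Wsym mu U -> Wsym mu U' -> m x = fine (marginal mu U x) ->
    (marginal mu U x <= marginal mu U' x)%E ->
    admissible U cu h1 -> admissible U' cu h1' ->
    admissible U cv h2 -> ku = kernel_op mu U h2 x ->
    (1 + m x) ^+ n * `|h1 x * ku - h1' x * ku'| <=
    (cv 0%N + 1) * ((1 + m x) ^+ n.+1 * `|h1 x - h1' x|) + cu n * `|ku - ku'|.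
  move=> UU UU' mE lU a1 a1' a2 kuE.
  have ku0 : 0 <= ku by rewrite kuE; exact: (kernel_op_ge0 UU (adm_ge0 a2)).
  have [l|l] := lty_or_infty (marginal mu U x); last first.
    have l' : marginal mu U' x = +oo%E by apply/eqP; rewrite -leye_eq -l.
    rewrite (adm_infty a1 l) (adm_infty a1' l') !mul0r subrr normr0 !mulr0.
    by rewrite add0r mulr_ge0.
  apply: product_dist_le => //; first exact: (adm_ge0 a1').
  - by rewrite addr_ge0.
  - rewrite kuE mE; apply: le_trans (kernel_op_le UU (adm_meas a2) (adm_ge0 a2)
      (fun y => admissible_le y a2) l) _.
    by rewrite ler_wpM2r ?fine_marginal_ge0// lerDl.
  - have [l'|l'] := lty_or_infty (marginal mu U' x); last first.
      by rewrite (adm_infty a1' l') mulr0.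
    apply: le_trans (adm_bound a1' n x); apply: ler_wpM2r; first exact: (adm_ge0 a1').
    rewrite lerXn2r ?nnegrE ?addr_ge0 ?fine_marginal_ge0// lerD2l mE.
    by rewrite -lee_fin !marginal_fineK.
have [l|l] := leP (marginal mu W x) (marginal mu W' x).
  by apply: (key W W' _ _ hu hu' hv) => //; rewrite /min_marginal min_l.
rewrite distrC (distrC (hu x)) (distrC (kernel_op mu W hv x)).
apply: (key W' W _ _ hu' hu hv') => //; last exact: ltW.
by rewrite /min_marginal min_r// ltW.
Qed.

Lemma measurable_weighted_dist n (h h' : T -> R) :
  measurable_fun setT h -> measurable_fun setT h' ->
  measurable_fun setT (fun x => (1 + m x) ^+ n * `|h x - h' x|).
Proof.
move=> mh mh'; apply: measurable_funM; first exact: measurable_weight.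
by apply: measurableT_comp => //; exact: measurable_funB.
Qed.

Lemma close_pair_attach cu cv hu hu' hv hv' :
  close_pair W W' D cu hu hu' -> close_pair W W' D cv hv hv' ->
  close_pair W W' D (attach_const cu cv)
    (fun x => hu x * kernel_op mu W hv x)
    (fun x => hu' x * kernel_op mu W' hv' x).
Proof.
move=> [au au' du] [av av' dv].
split; [exact: admissible_attach|exact: admissible_attach|] => n.
have cu0 k := admissible_const_ge0 k WW au.
have cv0 k := admissible_const_ge0 k WW av.
have [mhu mhu' mhv mhv'] := And4 (adm_meas au) (adm_meas au') (adm_meas av) (adm_meas av').
have mk := measurable_kernel_op WW mhv (adm_ge0 av).
have mk' := measurable_kernel_op WW' mhv' (adm_ge0 av').
have mkd : measurable_fun setT (fun x => `|kernel_op mu W hv x - kernel_op mu W' hv' x|).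
  by apply: measurableT_comp => //; exact: measurable_funB.
have mud := measurable_weighted_dist n.+1 mhu mhu'.
have a0 : 0 <= cv 0%N + 1 by rewrite addr_ge0.
have dk : (\int[mu]_x `|kernel_op mu W hv x - kernel_op mu W' hv' x|%:E <=
    ((cv 0%N + 1 + cv 1%N) * D)%:E)%E.
  apply: le_trans (kernel_op_L1_dist WW WW' cutD mhv mhv' (adm_ge0 av) (adm_ge0 av')
    (c := cv 0%N + 1) _ _ _ _) _.
  - by rewrite ltr_pwDr.
  - by move=> y; rewrite (le_trans (admissible_le y av))// lerDl.
  - by move=> y; rewrite (le_trans (admissible_le y av'))// lerDl.
  - by move=> y l l'; rewrite (adm_infty av l) (adm_infty av' l').
  rewrite [leRHS](_ : _ = ((cv 0%N + 1) * D)%:E + (cv 1%N * D)%:E)%E; last first.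
    by rewrite -EFinD mulrDl.
  (* The factor [min_marginal] is at most its sum with 1, so the distance bound at exponent 1
     applies; this is the origin of [cv 1]. *)
  apply: leeD => //; apply: le_trans (dv 1%N); apply: ge0_le_integral => //.
  - by move=> y _; rewrite lee_fin mulr_ge0// min_marginal_ge0.
  - apply/measurable_EFinP/measurable_funM; first exact: measurable_min_marginal.
    by apply: measurableT_comp => //; exact: measurable_funB.
  - exact/measurable_EFinP/measurable_weighted_dist.
  - by move=> y _; rewrite lee_fin expr1 ler_wpM2r// lerDr.
apply: (@le_trans _ _ (\int[mu]_x ((cv 0%N + 1)%:E *
    ((1 + m x) ^+ n.+1 * `|hu x - hu' x|)%:E +
    (cu n)%:E * `|kernel_op mu W hv x - kernel_op mu W' hv' x|%:E))%E).
  apply: ge0_le_integral => //.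
  - by move=> x _; rewrite lee_fin mulr_ge0 ?weight_ge0.
  - by apply/measurable_EFinP/measurable_weighted_dist; exact: measurable_funM.
  - by apply/measurable_EFinP; apply: measurable_funD; apply: measurable_funM.
  - by move=> x _; rewrite -!EFinM -EFinD lee_fin; exact: attach_dist_pointwise.
rewrite ge0_integralD//; last 4 first.
- by move=> x _; rewrite -EFinM lee_fin !mulr_ge0 ?weight_ge0.
- by apply/measurable_EFinP; apply: measurable_funM.
- by move=> x _; rewrite -EFinM lee_fin mulr_ge0.
- by apply/measurable_EFinP; apply: measurable_funM.
rewrite !ge0_integralZl_EFin//; last 3 first.
- exact/measurable_EFinP.
- by move=> x _; rewrite lee_fin mulr_ge0 ?weight_ge0.
- exact/measurable_EFinP.
rewrite /attach_const mulrDl [leRHS]EFinD; apply: leeD.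
  rewrite (mulrC (cu n.+1)) -mulrA EFinM; apply: lee_wpmul2l; last exact: du.
  by rewrite lee_fin.
by rewrite -mulrA EFinM; apply: lee_wpmul2l => //; rewrite lee_fin.
Qed.

(** Supplies the scalar factor split off when an isolated vertex is removed. *)
Lemma close_pair_integral c h h' : close_pair W W' D c h h' ->
  exists x x' : R,
    [/\ (\int[mu]_y (h y)%:E)%E = x%:E, (\int[mu]_y (h' y)%:E)%E = x'%:E,
        0 <= x <= c 0%N, 0 <= x' <= c 0%N & `|x - x'| <= c 0%N * D].
Proof.
move=> [ah ah' dh].
have ih := admissible_integrable ah; have ih' := admissible_integrable ah'.
have := admissible_integral ah; have := admissible_integral ah'.
have fh := integrable_fin_num measurableT ih.
have fh' := integrable_fin_num measurableT ih'.
rewrite -(fineK fh) -(fineK fh') !lee_fin => b' b.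
exists (fine (\int[mu]_y (h y)%:E)%E), (fine (\int[mu]_y (h' y)%:E)%E).
split => //; rewrite -lee_fin -abse_EFin EFinB (fineK fh) (fineK fh').
rewrite -integralB//; apply: le_trans (dh 0%N).
under [leRHS]eq_integral do rewrite expr0 mul1r.
apply: le_trans (le_abse_integral _ measurableT _) _ => //.
apply/measurable_EFinP/measurable_funB; [exact: adm_meas ah|exact: adm_meas ah'].
Qed.

End Pairs.
End WeightedPairs.

(** * Elementary inequalities for the exponential *)

Section ExponentialWeight.
Context {R : realType}.

Definition exp_const (n : nat) : R := n.+1%:R ^+ n.+1.

(** With N = n + 1, one has 1 + l <= N(1 + l/N) <= N exp(l/N); the N-th power gives the bound.
    Taking n + 1 instead of n keeps the division legitimate at n = 0. *)
Lemma weighted_expRN_le n (l : R) : 0 <= l ->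
  (1 + l) ^+ n * expR (- l) <= exp_const n.
Proof.
move=> l0; have N0 : (0 : R) < n.+1%:R by rewrite ltr0n.
have N1 : (1 : R) <= n.+1%:R by rewrite ler1n.
have E : (1 + l) ^+ n.+1 <= exp_const n * expR l.
  rewrite -{2}(mulfVK (lt0r_neq0 N0) l) mulrC [_ * n.+1%:R]mulrC expRM_natl mulrC.
  rewrite -exprMn; apply: lerXn2r; rewrite ?nnegrE ?addr_ge0 ?mulr_ge0 ?expR_ge0 ?ler0n//.
  apply: le_trans (ler_wpM2l (ltW N0) (expR_ge1Dx _)).
  by rewrite mulrDr mulr1 (mulrC _ (l / _)) mulfVK ?gt_eqF// lerD2r.
rewrite expRN ler_pdivrMr ?expR_gt0//; apply: le_trans E.
by apply: ler_weXn2l => //; rewrite lerDl.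
Qed.

(** The difference is exp(-a)(1 - exp(a - b)), whose second factor is at most b - a; the first
    absorbs the polynomial weight, which is taken at the smaller point [a]. *)
Lemma weighted_expRN_dist_le n (a b : R) : 0 <= a -> a <= b ->
  (1 + a) ^+ n * `|expR (- a) - expR (- b)| <= exp_const n * `|a - b|.
Proof.
move=> a0 ab; rewrite distrC (distrC a) [X in _ * X <= _]ler0_norm; last first.
  by rewrite subr_le0 ler_expR lerN2.
rewrite (ger0_norm (_ : 0 <= b - a)) ?subr_ge0// opprB.
apply: le_trans (ler_wpM2r _ (weighted_expRN_le n a0)); last by rewrite subr_ge0.
rewrite -mulrA; apply: ler_wpM2l; first by rewrite exprn_ge0// addr_ge0.
have -> : - b = - a + (a - b) by ring.
rewrite expRD -{1}(mulr1 (expR (- a))) -mulrBr; apply: ler_wpM2l; first exact: expR_ge0.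
by have := expR_ge1Dx (a - b); lra.
Qed.
End ExponentialWeight.

(** * The initial weights exp(-lam) *)

Section IsolationWeight.
Context {R : realType} {d : measure_display} {T : measurableType d}.
Variable mu : probability T R.

Definition isol_weight (W : T -> T -> R) (x : T) : R :=
  fine (expeR (- marginal mu W x)).

Lemma isol_weightE W x : Wsym mu W ->
  isol_weight W x = if (marginal mu W x < +oo)%E
    then expR (- fine (marginal mu W x)) else 0.
Proof.
move=> WW; rewrite /isol_weight; case: ifPn => [l|]; last first.
  by rewrite -leNgt leye_eq => /eqP ->.
by rewrite -{1}(marginal_fineK WW l).
Qed.

Lemma admissible_isol_weight W : Wsym mu W ->
  admissible mu W exp_const (isol_weight W).
Proof.
move=> WW; split.
- rewrite (_ : isol_weight W = fun x => if (marginal mu W x < +oo)%E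
    then expR (- fine (marginal mu W x)) else 0); last first.
    by apply/funext => x; exact: isol_weightE.
  have ml := measurable_marginal WW.
  apply: measurable_fun_ifT => //; first exact: measurable_fun_lte.
  apply: measurableT_comp => //; apply: measurableT_comp => //.
  exact: measurableT_comp (fine_measurable measurableT) ml.
- by move=> x; rewrite isol_weightE//; case: ifP => // _; exact: expR_ge0.
- by move=> x l; rewrite isol_weightE// l.
- move=> n x; rewrite isol_weightE//; case: ifP => _; last by rewrite mulr0 exprn_ge0.
  exact/weighted_expRN_le/fine_marginal_ge0.
Qed.

Lemma close_pair_isol_weight W W' D : Wsym mu W -> Wsym mu W' ->
  cut_bounded mu W W' D ->
  close_pair mu W W' D exp_const (isol_weight W) (isol_weight W').
Proof.
move=> WW WW' cutD; have aW := admissible_isol_weight WW.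
have aW' := admissible_isol_weight WW'; split => // n.
have cE U : Wsym mu U -> forall x, kernel_op mu U (cst 1) x = fine (marginal mu U x).
  by move=> UU x; congr fine; apply: eq_integral => y _; rewrite mulr1.
have ml U : Wsym mu U -> measurable_fun setT (fine \o marginal mu U).
  by move=> UU; apply: measurableT_comp (fine_measurable measurableT) (measurable_marginal UU).
have mld : measurable_fun setT (fun x => `|fine (marginal mu W x) - fine (marginal mu W' x)|).
  by apply: measurableT_comp => //; apply: measurable_funB; exact: ml.
(* The marginal is T_W applied to the constant 1. Taking both weights equal to 1 in
   [kernel_op_L1_dist] kills its second term and leaves [D]. *)
have dl : (\int[mu]_x `|fine (marginal mu W x) - fine (marginal mu W' x)|%:E <= D%:E)%E.
  have := @kernel_op_L1_dist R d T mu W W' D WW WW' cutD (cst 1) (cst 1) 1.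
  under eq_integral do rewrite cE// cE//.
  rewrite mul1r => /(_ _ _ _ _ _ _ _ _) H.
  apply: le_trans (H _ _ _ _ _ _ _ _) _ => //.
  rewrite integral0_eq ?adde0// => y _ /=.
  by rewrite subrr normr0 mulr0.
apply: (@le_trans _ _ (\int[mu]_x ((exp_const n)%:E *
    `|fine (marginal mu W x) - fine (marginal mu W' x)|%:E))%E); last first.
  rewrite ge0_integralZl_EFin ?exprn_ge0//; last exact/measurable_EFinP.
  by rewrite EFinM; apply: lee_wpmul2l => //; rewrite lee_fin exprn_ge0.
apply: ae_ge0_le_integral => //.
- by move=> x _; rewrite lee_fin mulr_ge0 ?weight_ge0.
- apply/measurable_EFinP.
  by apply: measurable_weighted_dist => //; [exact: adm_meas aW|exact: adm_meas aW'].
- by move=> x _; rewrite -EFinM lee_fin mulr_ge0// exprn_ge0.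
- by apply/measurable_EFinP; apply: measurable_funM.
(* The comparison is made only where both marginals are finite: elsewhere [fine] replaces an
   infinite marginal by 0 and the pointwise bound can fail. *)
have := ae_marginal_lty WW; have := ae_marginal_lty WW'.
apply: filterS2 => x l' l _; rewrite -EFinM lee_fin.
rewrite !isol_weightE// l l' /min_marginal.
rewrite -(marginal_fineK WW l) -(marginal_fineK WW' l') /=.
have [ll|ll] := leP (fine (marginal mu W x)) (fine (marginal mu W' x)).
  rewrite min_l ?lee_fin//=; apply: weighted_expRN_dist_le => //.
  exact: fine_marginal_ge0.
rewrite min_r ?lee_fin ?(ltW ll)//= distrC (distrC (fine (marginal mu W x))).
by apply: weighted_expRN_dist_le; [exact: fine_marginal_ge0|exact: ltW].
Qed.
End IsolationWeight.

(** * Tree integrals and removal of a vertex *)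

Lemma measurable_prod_cond {R : realType} (d : measure_display)
    (T : measurableType d) (I : finType) (P : pred I) (h : I -> T -> R) :
  (forall i, P i -> measurable_fun setT (h i)) ->
  measurable_fun setT (fun x => \prod_(i | P i) h i x).
Proof.
move=> mh; have -> : (fun x => \prod_(i | P i) h i x) =
    fun x => \prod_i (if P i then h i x else 1).
  by apply/funext => x; rewrite big_mkcond.
by apply: measurable_prod => i _; case: (P i) (mh i) => [|_]; [apply|].
Qed.

Section TreeIntegral.
Context {R : realType} {d : measure_display} {T : measurableType d}.
Variables (mu : probability T R) (r : nat) (e : rel 'I_r).
Hypothesis e_sym : forall i j, e i j = e j i.
Hypothesis e_irr : forall i, ~~ e i i.

Local Notation co s k := (nth point s (nat_of_ord k)).

Definition edge_prod (W : T -> T -> R) (A : {set 'I_r}) (s : seq T) : R :=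
  \prod_(p : 'I_r * 'I_r |
      [&& (p.1 < p.2)%N && e p.1 p.2, p.1 \in A & p.2 \in A])
    W (co s p.1) (co s p.2).

Definition weight_prod (A : {set 'I_r}) (h : 'I_r -> T -> R) (s : seq T) : R :=
  \prod_(k in A) h k (co s k).

(** The integration always runs over all [r] coordinates; those outside [A] are idle and have total
    mass 1, so removing a vertex requires no reindexing. *)
Definition t_weighted (W : T -> T -> R) (A : {set 'I_r}) (h : 'I_r -> T -> R) :
    \bar R :=
  iint mu r (fun s => (edge_prod W A s * weight_prod A h s)%:E).

Definition attach (W : T -> T -> R) (h : 'I_r -> T -> R) (v u : 'I_r) :
    'I_r -> T -> R :=
  fun k => if k == u then (fun x => h u x * kernel_op mu W (h v) x) else h k.

Lemma eq_edge_prod W (A : {set 'I_r}) (s s' : seq T) : {in A, forall k, co s k = co s' k} ->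
  edge_prod W A s = edge_prod W A s'.
Proof. by move=> ss; apply: eq_bigr => p /and3P[_ p1 p2]; rewrite !ss. Qed.

Lemma edge_prod_isolated W (A : {set 'I_r}) v s :
  (forall w, w \in A -> ~~ e v w) -> edge_prod W A s = edge_prod W (A :\ v) s.
Proof.
move=> iso; apply: eq_bigl => -[i j] /=; rewrite !inE.
have [ij|] := boolP ((i < j)%N && e i j) => //=.
case/andP: ij => _ eij.
have [iv|] := eqVneq i v => /=; first subst i.
  by have [/iso|] := boolP (j \in A); rewrite ?eij ?andbF.
have [jv|//] := eqVneq j v => /=; subst j.
by have [/iso|] := boolP (i \in A); rewrite ?andbF// e_sym eij.
Qed.

Lemma edge_prod_leaf W (A : {set 'I_r}) v u s :
  (forall x y, W x y = W y x) ->
  v \in A -> u \in A -> e v u ->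
  (forall w, w \in A -> e v w -> w = u) ->
  edge_prod W A s = W (co s u) (co s v) * edge_prod W (A :\ v) s.
Proof.
move=> symW vA uA evu uniq_u.
have uv : u != v by apply: contraTneq evu => ->; exact: e_irr.
(* The edge between [u] and [v], oriented increasingly as in the index set of the product. *)
pose p0 := if (u < v)%N then (u, v) else (v, u).
have p0P : [&& (p0.1 < p0.2)%N && e p0.1 p0.2, p0.1 \in A & p0.2 \in A].
  rewrite /p0; case: (ltngtP u v) => [l|l|/ord_inj l] /=.
  - by rewrite l e_sym evu uA vA.
  - by rewrite l evu uA vA.
  - by rewrite l eqxx in uv.
rewrite /edge_prod (bigD1 p0 p0P) /=; congr (_ * _).
  by rewrite /p0; case: ifP => //= _; exact: symW.
apply: eq_bigl => -[i j] /=; rewrite !inE /p0.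
have [/andP[ij eij]|] := boolP ((i < j)%N && e i j) => //=.
have [iv|iv] := eqVneq i v => /=.
  subst i; have [jA|] := boolP (j \in A); rewrite ?andbF//=.
  have ju := uniq_u j jA eij; subst j.
  by rewrite ltnNge (ltnW ij) /= eqxx andbF.
have [jv|jv] := eqVneq j v => /=.
  subst j; rewrite andbF; have [iA|//] := boolP (i \in A) => /=.
  rewrite e_sym in eij; have iu := uniq_u i iA eij; subst i.
  by rewrite ij eqxx andbF.
rewrite [X in _ && X](_ : _ = true) ?andbT//.
by case: ifP => _; rewrite xpair_eqE negb_and ?iv ?jv ?orbT.
Qed.

Lemma jmeas_tree W (A : {set 'I_r}) h : Wsym mu W -> (forall k, measurable_fun setT (h k)) ->
  @jmeas R d T _ unit r
    (fun _ s => (edge_prod W A s * weight_prod A h s)%:E).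
Proof.
move=> [mW _] mh dq Q p s mp ss ms; apply/measurable_EFinP; apply: measurable_funM.
- apply: measurable_prod_cond => -[i j] _ /=.
  apply: (measurableT_comp mW (g := fun q => (co (s q) i, co (s q) j))).
  exact: measurable_fun_pair.
- by apply: measurable_prod_cond => k _; apply: (measurableT_comp (mh k)).
Qed.

Lemma edge_prod_ge0 W A s : Wsym mu W -> 0 <= edge_prod W A s.
Proof. by move=> [_ [_ [_ W0]]]; apply: prodr_ge0 => p _. Qed.

Lemma weight_prod_ge0 A h s : (forall k x, 0 <= h k x) -> 0 <= weight_prod A h s.
Proof. by move=> h0; apply: prodr_ge0 => k _. Qed.

Lemma co_set_nth (v k : 'I_r) (s : seq T) y : k != v -> co (set_nth point s v y) k = co s k.
Proof.
by move=> kv; rewrite nth_set_nth /=; case: eqP => // /ord_inj E; rewrite E eqxx in kv.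
Qed.

Lemma co_set_nth_eq (v : 'I_r) (s : seq T) y : co (set_nth point s v y) v = y.
Proof. by rewrite nth_set_nth /= eqxx. Qed.

Lemma weight_prod_set_nth (A : {set 'I_r}) h v s y : v \in A ->
  weight_prod A h (set_nth point s v y) = h v y * weight_prod (A :\ v) h s.
Proof.
move=> vA; rewrite /weight_prod (big_setD1 v)//= co_set_nth_eq; congr (_ * _).
by apply: eq_bigr => k; rewrite !inE => /andP[kv _]; rewrite co_set_nth.
Qed.

Lemma edge_prod_set_nth W (A : {set 'I_r}) v s y :
  edge_prod W (A :\ v) (set_nth point s v y) = edge_prod W (A :\ v) s.
Proof.
by apply: eq_edge_prod => k; rewrite !inE => /andP[kv _]; rewrite co_set_nth.
Qed.

(** Once moved innermost, the variable of [v] occurs only in [h v], so its integral is a constant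
    factor. *)
Lemma t_weighted_isolated W (A : {set 'I_r}) c h v :
  Wsym mu W -> (forall k, admissible mu W (c k) (h k)) ->
  v \in A -> (forall w, w \in A -> ~~ e v w) ->
  (t_weighted W A h = \int[mu]_y (h v y)%:E * t_weighted W (A :\ v) h)%E.
Proof.
move=> WW ah vA iso.
have mh k := adm_meas (ah k); have h0 k := adm_ge0 (ah k).
have pos B s : (0 <= (edge_prod W B s * weight_prod B h s)%:E)%E.
  by rewrite lee_fin mulr_ge0 ?edge_prod_ge0 ?weight_prod_ge0.
have iv : (\int[mu]_y (h v y)%:E)%E \is a fin_num.
  exact: (integrable_fin_num measurableT (admissible_integrable (ah v))).
rewrite /t_weighted (iint_innermost mu (ltn_ord v))//; last exact: jmeas_tree.
rewrite -(fineK iv) -iintZ//; last 2 first.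
- by rewrite fine_ge0//; apply: integral_ge0 => y _; rewrite lee_fin.
- exact: jmeas_tree.
apply: eq_iint => s _; rewrite (fineK iv).
under eq_integral => y _.
  rewrite (edge_prod_isolated _ _ iso) edge_prod_set_nth weight_prod_set_nth//.
  rewrite mulrCA EFinM; over.
by rewrite ge0_integralZr//; [exact/measurable_EFinP|move=> y _; rewrite lee_fin].
Qed.

(** Once moved innermost, the variable of [v] occurs only in [h v] and in the edge to [u]; its
    integral is T_W (h v) at the coordinate of [u], which joins the weight there. *)
Lemma t_weighted_leaf W (A : {set 'I_r}) c h v u :
  Wsym mu W -> (forall k, admissible mu W (c k) (h k)) ->
  v \in A -> u \in A -> e v u ->
  (forall w, w \in A -> e v w -> w = u) ->
  t_weighted W A h = t_weighted W (A :\ v) (attach W h v u).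
Proof.
move=> WW ah vA uA evu uniq_u.
have mh k := adm_meas (ah k); have h0 k := adm_ge0 (ah k).
have uv : u != v by apply: contraTneq evu => ->; exact: e_irr.
have uAv : u \in A :\ v by rewrite !inE uv.
rewrite /t_weighted (iint_innermost mu (ltn_ord v))//; last 2 first.
- exact: jmeas_tree.
- by move=> s; rewrite lee_fin mulr_ge0 ?edge_prod_ge0 ?weight_prod_ge0.
apply: eq_iint => s _.
have symW : forall x y, W x y = W y x by case: WW => _ [_ []].
have W0 : forall x y, 0 <= W x y by case: WW => _ [_ []].
have attachE : weight_prod (A :\ v) (attach W h v u) s =
    kernel_op mu W (h v) (co s u) * weight_prod (A :\ v) h s.
  rewrite /weight_prod !(big_setD1 u uAv) /= /attach eqxx mulrA; congr (_ * _).
    by rewrite mulrC.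
  by apply: eq_bigr => k; rewrite !inE => /andP[/negbTE -> _].
rewrite attachE.
under eq_integral => y _.
  rewrite (edge_prod_leaf _ symW vA uA evu uniq_u) edge_prod_set_nth.
  rewrite weight_prod_set_nth// co_set_nth// co_set_nth_eq.
  rewrite mulrACA EFinM; over.
rewrite ge0_integralZr//; last 3 first.
- apply/measurable_EFinP; exact: (measurable_kernelM_section WW (mh v)).
- by move=> y _; rewrite lee_fin mulr_ge0.
- by rewrite lee_fin mulr_ge0 ?edge_prod_ge0 ?weight_prod_ge0.
have [l|l] := lty_or_infty (marginal mu W (co s u)).
  rewrite -(kernel_op_fineK WW (mh v) (h0 v) (fun y => admissible_le y (ah v)) l).
  by rewrite -EFinM mulrCA.
(* At an infinite marginal [kernel_op] need not equal the integral, but [h u] vanishes there and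
   both sides are 0. *)
rewrite {1 2}/weight_prod (big_setD1 u uAv)/=.
by rewrite (adm_infty (ah u) l) !(mul0r, mulr0) mule0.
Qed.

End TreeIntegral.

(** * Induction over vertex removals *)

Section ForestBound.
Variables (R : realType) (r : nat) (e : rel 'I_r).
Hypothesis e_sym : forall i j, e i j = e j i.
Hypothesis e_irr : forall i, ~~ e i i.
Hypothesis acyclic : forall c : seq 'I_r, (3 <= size c)%N -> ~ ucycle e c.

(* The induction runs over vertex subsets, to which acyclicity, unlike
   connectedness, is inherited. *)
Lemma t_weighted_lipschitz (A : {set 'I_r}) (c : 'I_r -> nat -> R) :
  exists2 C : R, 0 <= C &
  forall (d : measure_display) (T : measurableType d) (mu : probability T R)
         (W W' : T -> T -> R) (D : R) (h h' : 'I_r -> T -> R),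
    Wsym mu W -> Wsym mu W' -> cut_bounded mu W W' D ->
    (forall k, close_pair mu W W' D (c k) (h k) (h' k)) ->
    exists t t' : R,
      [/\ t_weighted mu e W A h = t%:E, t_weighted mu e W' A h' = t'%:E,
          0 <= t <= C, 0 <= t' <= C & `|t - t'| <= C * D].
Proof.
have [n] := ubnP #|A|; elim: n A c => // n IH A c; rewrite ltnS => cardA.
have [->|A0] := eqVneq A finset.set0.
  exists 1 => // d T mu W W' D h h' WW WW' cutD _; exists 1, 1.
  have E U k : t_weighted mu e U finset.set0 k = 1%:E.
    rewrite /t_weighted (@eq_iint R d T mu r _ (cst 1%E)) ?iint1// => s _.
    rewrite /edge_prod /weight_prod big_set0 mulr1 big_pred0// => p.
    by rewrite !finset.in_set0 /= andbF.
  split; rewrite ?E ?ler01 ?lexx// subrr normr0 mul1r.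
  exact: cut_bounded_ge0 cutD.
have [v vA leaf] := acyclic_low_degree e_sym e_irr acyclic A0.
have cardAv : (#|A :\ v| < n)%N.
  by apply: leq_trans cardA; rewrite [ltnRHS](cardsD1 v) vA.
have [/existsP[u /andP[uA evu]]|/existsPn iso] :=
    boolP [exists u, (u \in A) && e v u].
  have uniq_u w : w \in A -> e v w -> w = u.
    by move=> wA evw; exact: leaf wA uA evw evu.
  (* The new constants depend only on [c], [u] and [v], so [C] is fixed before any probability space
     or kernel is introduced. *)
  pose c' k := if k == u then attach_const (c u) (c v) else c k.
  have [C C0 HC] := IH (A :\ v) c' cardAv; exists C => //.
  move=> d T mu W W' D h h' WW WW' cutD hh'.
  rewrite (t_weighted_leaf e_sym e_irr WW (fun k => close_adm (hh' k)) vA uA evu)//.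
  rewrite (t_weighted_leaf e_sym e_irr WW' (fun k => close_adm' (hh' k)) vA uA evu)//.
  apply: HC => // k; rewrite /c' /attach; case: eqP => // _.
  exact: (close_pair_attach WW WW' cutD (hh' u) (hh' v)).
have {}iso w : w \in A -> ~~ e v w.
  by move=> wA; have := iso w; rewrite wA.
have [C C0 HC] := IH (A :\ v) c cardAv.
(* No weight is available yet to show that [c v 0] is nonnegative, hence the absolute value; [aE]
   removes it later. The factor 2 counts the two telescoping terms, each at most a C D. *)
pose a := `|c v 0%N|; exists (2 * a * C); first by rewrite !mulr_ge0 ?normr_ge0.
move=> d T mu W W' D h h' WW WW' cutD hh'.
rewrite (t_weighted_isolated e_sym WW (fun k => close_adm (hh' k)) vA iso).
rewrite (t_weighted_isolated e_sym WW' (fun k => close_adm' (hh' k)) vA iso).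
have [t [t' [-> -> /andP[t0 tC] /andP[t'0 t'C] tt']]] :=
  HC d T mu W W' D h h' WW WW' cutD hh'.
have [x [x' [-> -> /andP[x0 xc] /andP[x'0 x'c] xx']]] := close_pair_integral (hh' v).
have aE : c v 0%N = a by rewrite /a ger0_norm// (le_trans x0).
rewrite aE in xc x'c xx'.
have a0 : 0 <= a by rewrite -aE (le_trans x0)// aE.
have aC : a * C <= 2 * a * C by rewrite -mulrA ler_peMl ?mulr_ge0// ler1n.
exists (x * t), (x' * t'); split; rewrite ?EFinM//.
- by rewrite mulr_ge0// (le_trans _ aC)// ler_pM.
- by rewrite mulr_ge0// (le_trans _ aC)// ler_pM.
have -> : x * t - x' * t' = (x - x') * t + x' * (t - t') by ring.
rewrite (le_trans (ler_normD _ _))// !normrM (ger0_norm t0) (ger0_norm x'0).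
have E1 : `|x - x'| * t <= a * D * C by exact: ler_pM.
have E2 : x' * `|t - t'| <= a * (C * D) by exact: ler_pM.
by apply: le_trans (lerD E1 E2) _; lra.
Qed.
End ForestBound.

(** * From test functions back to the cut norm *)

Lemma cut_norm_ge0 {R : realType} (d : measure_display) (T : measurableType d)
    (mu : probability T R) (U : T -> T -> R) : (0 <= cut_norm mu U)%E.
Proof.
apply: le_trans (abse_ge0 _) (ereal_sup_ubound _).
by exists (cst 0), (cst 0); split => // x; rewrite normr0.
Qed.

Theorem mainTheorem11 (R : realType) (r : nat) (e : rel 'I_r) :
  is_tree e ->
  exists C : R,
    forall (d : measure_display) (T : measurableType d) (mu : probability T R)
           (W W' : T -> T -> R),
      Wsym mu W -> Wsym mu W' ->
      (t_isol mu e W <= C%:E)%E /\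
      (`| t_isol mu e W - t_isol mu e W' |%E
         <= C%:E * cut_norm mu (fun x y => (W x y - W' x y)%R))%E.
Proof.
move=> [[e_sym e_irr] [_ acyclic]].
have [C C0 HC] := @t_weighted_lipschitz R r e e_sym e_irr acyclic
  [set: 'I_r]%SET (fun=> exp_const).
(* A strictly positive constant makes the right-hand side infinite when the cut norm is. *)
exists (C + 1) => d T mu W W' WW WW'.
pose t_ U := t_weighted mu e U [set: 'I_r]%SET (fun=> isol_weight mu U).
have tE U : t_isol mu e U = t_ U.
  apply: eq_iint => s _; rewrite /edge_prod /weight_prod; congr (_ * _)%:E.
    by apply: eq_bigl => p; rewrite !finset.in_setT !andbT.
  by apply: eq_bigl => k; rewrite finset.in_setT.
rewrite !tE.
have bound U D : Wsym mu U -> cut_bounded mu W U D -> exists t t' : R,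
    [/\ t_ W = t%:E, t_ U = t'%:E, 0 <= t <= C, 0 <= t' <= C &
        `|t - t'| <= C * D].
  by move=> UU cutD; apply: HC => // k; exact: close_pair_isol_weight.
have -> : (t_ W <= (C + 1)%:E)%E.
  (* Comparing [W] with itself at [D = 0] gives the uniform bound whatever the cut norm of W -
     W'. *)
  have [|t [_ [-> _ /andP[_ tC] _ _]]] := bound W 0 WW.
    move=> f g _ _ _ _; rewrite integral0_eq ?normr0 ?abse0// => z _.
    by rewrite subrr mulr0.
  by rewrite lee_fin (le_trans tC)// lerDl.
split=> //.
set N := cut_norm _ _.
have N0 : (0 <= N)%E by exact: cut_norm_ge0.
have NP (f g : T -> R) : measurable_fun setT f -> measurable_fun setT g ->
    (forall x, `|f x| <= 1) -> (forall x, `|g x| <= 1) ->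
    (`| \int[mu \x mu]_z (f z.1 * g z.2 * (W z.1 z.2 - W' z.1 z.2))%:E | <= N)%E.
  by move=> mf mg f1 g1; apply: ereal_sup_ubound; exists f, g.
have [fN|->] := lty_or_infty N; last by rewrite gt0_muley ?leey// lte_fin ltr_wpDl.
have NE : N = (fine N)%:E by rewrite fineK// ge0_fin_numE.
have [|t [t' [-> -> _ _ tt']]] := bound W' (fine N) WW'.
  by move=> f g mf mg f1 g1; rewrite -NE; exact: NP.
have fN0 : 0 <= fine N by exact: fine_ge0.
rewrite NE -EFinB -EFinM abse_EFin lee_fin (le_trans tt')//.
by rewrite ler_wpM2r// lerDl.
Qed.
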